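(* Let $n$ be a positive integer, let $R\in\mathbb{R}^{n\times n}$ be a symmetric positive definite matrix, let $a<b$ be integers, and put $\ell=b-a+1$. For any sequence $u:\{a,a+1,\dots,b\}\to\mathbb{R}^n$, written $u_k=u(k)$, define $$\upsilon_2=\sum_{k=a}^b\sum_{s=a}^k u_s,\qquad \upsilon_3=\sum_{k=a}^b\sum_{s=a}^k\sum_{i=a}^s u_i,\qquad \zeta_4=\upsilon_2-\frac{3}{\ell+2}\upsilon_3,$$ and $$J_2(u)=\sum_{k=a}^b\sum_{s=a}^k u_s^TRu_s-\frac{2}{\ell(\ell+1)}\Big(\sum_{k=a}^b\sum_{s=a}^k u_s\Big)^TR\Big(\sum_{k=a}^b\sum_{s=a}^k u_s\Big).$$ Then $$J_2(u)\ \geq\ \frac{16(\ell+2)}{\ell(\ell^2-1)}\,\zeta_4^TR\zeta_4 .$$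
   Context: $\ell$ is the number of integers in the interval $[a,b]$. $J_2(u)$ is the gap (left-hand side minus right-hand side) in the double-sum discrete Jensen inequality $\sum_{k=a}^b\sum_{s=a}^k u_s^TRu_s\ge \frac{2}{\ell(\ell+1)}(\sum_{k=a}^b\sum_{s=a}^k u_s)^TR(\sum_{k=a}^b\sum_{s=a}^k u_s)$. *)

(* Defs.v *)
From mathcomp Require Import all_boot all_order all_algebra.
From mathcomp Require Import reals.

Set Implicit Arguments.
Unset Strict Implicit.
Unset Printing Implicit Defensive.

Import Order.TTheory GRing.Theory Num.Theory.
Local Open Scope ring_scope.

(* The integers k with a <= k <= b in increasing order (none if b < a), so that
   \sum_(k <- int_range a b) F k is the sum of F k for k from a to b. *)
Definition int_range (a b : int) : seq int :=
  [seq a + i%:Z | i <- iota 0 (if a <= b then `|b - a|%N.+1 else 0%N)].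

Lemma int_range_uniq (a b : int) : uniq (int_range a b).
Proof.
by rewrite map_inj_uniq ?iota_uniq // => i j /addrI [].
Qed.

Lemma mem_int_range (a b k : int) : (k \in int_range a b) = (a <= k <= b).
Proof.
apply/mapP/andP => [[i]|[ak kb]].
  rewrite mem_iota add0n /=; case: ifP => // ab ltib ->.
  rewrite lerDl -lerBrDl; split=> //.
  by rewrite -[b - a]gez0_abs ?subr_ge0 // lez_nat.
exists `|k - a|%N; last by rewrite gez0_abs ?subr_ge0 // subrKC.
rewrite mem_iota add0n (le_trans ak kb) /= ltnS -lez_nat.
by rewrite !gez0_abs ?subr_ge0 ?(le_trans ak kb) // lerD2r.
Qed.

Definition quadform (K : realType) (n : nat) (R : 'M[K]_n) (x : 'cV[K]_n) : K :=
  (x^T *m R *m x) 0 0.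

Definition sym_posdef (K : realType) (n : nat) (R : 'M[K]_n) : Prop :=
  R^T = R /\ forall x : 'cV[K]_n, x != 0 -> 0 < quadform R x.

(* A sequence on {a, a+1, ..., b} is given by a function on int, whose values
   outside [a, b] never enter the sums below. *)
Definition upsilon2 (K : realType) (n : nat) (a b : int)
    (u : int -> 'cV[K]_n) : 'cV[K]_n :=
  \sum_(k <- int_range a b) \sum_(s <- int_range a k) u s.

Definition upsilon3 (K : realType) (n : nat) (a b : int)
    (u : int -> 'cV[K]_n) : 'cV[K]_n :=
  \sum_(k <- int_range a b) \sum_(s <- int_range a k)
    \sum_(i <- int_range a s) u i.

Definition ell (K : realType) (a b : int) : K := (b - a + 1)%:~R.
Arguments ell : clear implicits.

Definition zeta4 (K : realType) (n : nat) (a b : int)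
    (u : int -> 'cV[K]_n) : 'cV[K]_n :=
  upsilon2 a b u - (3 / (ell K a b + 2)) *: upsilon3 a b u.

Definition J2 (K : realType) (n : nat) (R : 'M[K]_n) (a b : int)
    (u : int -> 'cV[K]_n) : K :=
  (\sum_(k <- int_range a b) \sum_(s <- int_range a k) quadform R (u s))
  - 2 / (ell K a b * (ell K a b + 1)) * quadform R (upsilon2 a b u).

(* Main.v *)
Require Import Defs.
From mathcomp Require Import all_boot all_order all_algebra.
From mathcomp Require Import reals.
From mathcomp Require Import zify ring.

Import Order.TTheory GRing.Theory Num.Theory.
Local Open Scope ring_scope.

(** The claim is a Bessel inequality.  Put [L] for the length of the interval.
    The value [u (a + i)] occurs [L - i] times in the double sum and
    ['C(L - i + 1, 2)] times in the triple sum ([sum_int_range2],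
    [sum_int_range3]).  Hence, for the scalar product on sequences with weights
    [w i = L - i],
    - [upsilon2] is the inner product of [u] with the constant sequence 1;
    - [zeta4] is the inner product of [u] with the affine sequence
      [p i = 1 - 3 (w i + 1) / (2 (L + 2))].
    The coefficient [3 / (L + 2)] is the one that makes [p] orthogonal to 1
    ([zeta_weight_orthogonal]).  The squared norms of 1 and [p] are
    [L (L + 1) / 2] and [L (L ^ 2 - 1) / (16 (L + 2))]
    ([const_weight_norm], [zeta_weight_norm]), the inverses of the two
    constants of the statement.  Subtracting from [u] its projection on 1 lowers
    the weighted energy by exactly the Jensen term, so that [J2] is the energy
    of the remainder; that remainder has the same inner product [zeta4] with [p],
    and its own projection on [p] accounts for the right-hand side
    ([weighted_pythagoras], [weighted_bessel2]). *)

(** * Iterated sums over integer intervals *)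

Lemma sum_int_range (V : nmodType) (a : int) (m : nat) (F : int -> V) :
  \sum_(k <- int_range a (a + m%:Z)) F k = \sum_(i < m.+1) F (a + i%:Z).
Proof.
rewrite /int_range lerDl lez_nat leq0n addrAC subrr add0r absz_nat.
rewrite big_map -(big_mkord xpredT (fun i => F (a + i%:Z))).
by rewrite /index_iota subn0.
Qed.

(** Counting with multiplicity: the hockey-stick identity, coefficient by
    coefficient.  It is stated for all [r] because each further summation
    raises [r] by one. *)
Lemma sum_partial_sums_bin (V : nmodType) (r n : nat) (G : nat -> V) :
  \sum_(i < n) \sum_(j < i.+1) G j *+ 'C(i - j + r, r)
  = \sum_(j < n) G j *+ 'C(n - j + r, r.+1).
Proof.
elim: n => [|n IHn]; first by rewrite !big_ord0.
rewrite big_ord_recr /= {}IHn.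
(* the term j = n may be added to the first sum, as 'C(r, r.+1) = 0 *)
have -> : \sum_(j < n) G j *+ 'C(n - j + r, r.+1)
    = \sum_(j < n.+1) G j *+ 'C(n - j + r, r.+1).
  by rewrite big_ord_recr /= subnn add0n bin_small // mulr0n addr0.
rewrite -big_split /=; apply: eq_bigr => j _.
by rewrite -mulrnDr subSn ?addSn ?binS // -ltnS.
Qed.

Lemma sum_int_range2 (V : nmodType) (a : int) (m : nat) (F : int -> V) :
  \sum_(k <- int_range a (a + m%:Z)) \sum_(s <- int_range a k) F s
  = \sum_(i < m.+1) F (a + i%:Z) *+ (m.+1 - i).
Proof.
rewrite sum_int_range; under eq_bigr do rewrite sum_int_range.
transitivity (\sum_(i < m.+1) F (a + i%:Z) *+ 'C(m.+1 - i + 0, 1)).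
  rewrite -(sum_partial_sums_bin V 0 m.+1 (fun i => F (a + i%:Z))).
  by apply: eq_bigr => i _; apply: eq_bigr => j _; rewrite bin0.
by apply: eq_bigr => i _; rewrite addn0 bin1.
Qed.

Lemma sum_int_range3 (V : nmodType) (a : int) (m : nat) (F : int -> V) :
  \sum_(k <- int_range a (a + m%:Z)) \sum_(s <- int_range a k)
    \sum_(t <- int_range a s) F t
  = \sum_(i < m.+1) F (a + i%:Z) *+ 'C((m.+1 - i).+1, 2).
Proof.
rewrite sum_int_range; under eq_bigr do rewrite sum_int_range2.
under [RHS]eq_bigr do rewrite -[(_ - _).+1]addn1.
rewrite -(sum_partial_sums_bin V 1 m.+1 (fun i => F (a + i%:Z))).
apply: eq_bigr => i _; apply: eq_bigr => j _.
by rewrite bin1 addn1 subSn // -ltnS.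
Qed.

(** * Weighted Bessel inequality for a quadratic form *)

Section Bessel.

Variables (K : realType) (n : nat) (R : 'M[K]_n).
Implicit Types x y z : 'cV[K]_n.

Lemma quadform_subZ x z (c : K) : R^T = R ->
  quadform R (x - c *: z)
  = quadform R x - 2 * c * (x^T *m R *m z) 0 0 + c ^+ 2 * quadform R z.
Proof.
move=> symR.
have zRx : (z^T *m R *m x) 0 0 = (x^T *m R *m z) 0 0.
  rewrite -[in LHS](trmxK (z^T *m R *m x)) mxE.
  by rewrite !trmx_mul trmxK symR mulmxA.
rewrite /quadform.
have -> : (x - c *: z)^T = x^T - c *: z^T by rewrite raddfB /= linearZ.
rewrite !mulmxBl !mulmxBr -!scalemxAl -!scalemxAr.
have entryB (A B : 'M[K]_1) : (A - B) 0 0 = A 0 0 - B 0 0 by rewrite !mxE.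
have entryZ d (A : 'M[K]_1) : (d *: A) 0 0 = d * A 0 0 by rewrite mxE.
by rewrite !(entryB, entryZ) zRx; ring.
Qed.

Lemma quadform_ge0 x : sym_posdef R -> 0 <= quadform R x.
Proof.
move=> [_ posR]; have [->|/posR/ltW//] := eqVneq x 0.
by rewrite /quadform mulmx0 mxE.
Qed.

Variables (I : finType) (w : I -> K).

(** Pythagoras for the projection of the vector-valued family [x] on the line
    spanned by the scalar family [p]; [N] is the squared norm of [p]. *)
Lemma weighted_pythagoras (p : I -> K) (N : K) (x : I -> 'cV[K]_n) :
    R^T = R -> N != 0 -> \sum_i w i * p i ^+ 2 = N ->
  let z := \sum_i (w i * p i) *: x i in
  \sum_i w i * quadform R (x i)
  = N^-1 * quadform R z + \sum_i w i * quadform R (x i - (p i / N) *: z).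
Proof.
move=> symR N0 normp z.
under [in RHS]eq_bigr do rewrite quadform_subZ // mulrDr mulrBr.
rewrite big_split sumrB /=.
have -> : \sum_i w i * (2 * (p i / N) * ((x i)^T *m R *m z) 0 0)
    = 2 / N * quadform R z.
  have zT : z^T = \sum_i (w i * p i) *: (x i)^T.
    by rewrite raddf_sum; apply: eq_bigr => i _; rewrite /= linearZ.
  rewrite /quadform zT !mulmx_suml summxE mulr_sumr.
  apply: eq_bigr => i _.
  by rewrite -!scalemxAl [in RHS]mxE; ring.
have -> : \sum_i w i * ((p i / N) ^+ 2 * quadform R z) = N^-1 * quadform R z.
  transitivity (N ^- 2 * quadform R z * \sum_i w i * p i ^+ 2).
    by rewrite mulr_sumr; apply: eq_bigr => i _; rewrite expr_div_n; ring.
  by rewrite normp; field.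
by ring.
Qed.

(** Projecting first on [p] and then on [q] proves Bessel: as [p] and [q] are
    orthogonal, the first step leaves the inner product with [q] unchanged. *)
Lemma weighted_bessel2 (p q : I -> K) (Np Nq : K) (x : I -> 'cV[K]_n) :
    sym_posdef R -> (forall i, 0 <= w i) -> Np != 0 -> Nq != 0 ->
    \sum_i w i * p i ^+ 2 = Np -> \sum_i w i * q i ^+ 2 = Nq ->
    \sum_i w i * q i * p i = 0 ->
  Np^-1 * quadform R (\sum_i (w i * p i) *: x i)
  + Nq^-1 * quadform R (\sum_i (w i * q i) *: x i)
  <= \sum_i w i * quadform R (x i).
Proof.
move=> posR w0 Np0 Nq0 normp normq orth; have symR := posR.1.
rewrite (weighted_pythagoras p Np x symR Np0 normp) lerD2l.
set z := \sum_i (w i * p i) *: x i.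
rewrite (weighted_pythagoras q Nq _ symR Nq0 normq).
have -> : \sum_i (w i * q i) *: (x i - (p i / Np) *: z)
    = \sum_i (w i * q i) *: x i.
  under eq_bigr do rewrite scalerBr scalerA mulrA.
  by rewrite sumrB -scaler_suml -mulr_suml orth mul0r scale0r subr0.
rewrite lerDl; apply: sumr_ge0 => i _.
by rewrite mulr_ge0 // quadform_ge0.
Qed.

End Bessel.

(** * Moments of the weights *)

Section Moments.

Variable K : realType.

Lemma sum_ord_revS (n : nat) (f : K -> K) :
  \sum_(i < n) f (n - i)%:R = \sum_(i < n) f i.+1%:R.
Proof.
rewrite [RHS](reindex_inj rev_ord_inj) /=; apply: eq_bigr => i _.
by rewrite subnSK.
Qed.

Lemma const_weight_norm (n : nat) :
  \sum_(i < n) ((n - i)%:R * 1 ^+ 2 : K) = n%:R * (n%:R + 1) / 2.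
Proof.
rewrite (sum_ord_revS n (fun t => t * 1 ^+ 2)).
elim: n => [|n IHn]; first by rewrite big_ord0 !mul0r.
by rewrite big_ord_recr /= IHn -natr1; field.
Qed.

Lemma sum_weight_sqr (n : nat) :
  \sum_(i < n) ((n - i)%:R ^+ 2 : K) = n%:R * (n%:R + 1) * (2 * n%:R + 1) / 6.
Proof.
rewrite (sum_ord_revS n (fun t => t ^+ 2)).
elim: n => [|n IHn]; first by rewrite big_ord0 !mul0r.
by rewrite big_ord_recr /= IHn -natr1; field.
Qed.

Lemma sum_weight_cube (n : nat) :
  \sum_(i < n) ((n - i)%:R ^+ 3 : K) = (n%:R * (n%:R + 1) / 2) ^+ 2.
Proof.
rewrite (sum_ord_revS n (fun t => t ^+ 3)).
elim: n => [|n IHn]; first by rewrite big_ord0 !mul0r expr0n.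
by rewrite big_ord_recr /= IHn -natr1; field.
Qed.

(** The factor by which [zeta4] multiplies the weight [n - i] of the [i]-th
    value; it is affine in that weight because
    ['C(w + 1, 2) = w (w + 1) / 2]. *)
Definition zeta_weight (n i : nat) : K :=
  1 - 3 / (n%:R + 2) * (((n - i)%:R + 1) / 2).

Lemma zeta_weight_orthogonal (n : nat) :
  \sum_(i < n) ((n - i)%:R * zeta_weight n i * 1) = 0.
Proof.
have n2 : (n%:R + 2 : K) != 0 by rewrite -natrD addn2 pnatr_eq0.
set c : K := 3 / (n%:R + 2) / 2.
have -> : \sum_(i < n) ((n - i)%:R * zeta_weight n i * 1)
    = (1 - c) * \sum_(i < n) ((n - i)%:R * 1 ^+ 2)
      - c * \sum_(i < n) (n - i)%:R ^+ 2.
  rewrite !mulr_sumr -sumrB; apply: eq_bigr => i _.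
  by rewrite /zeta_weight /c; field.
by rewrite const_weight_norm sum_weight_sqr /c; field.
Qed.

Lemma zeta_weight_norm (n : nat) :
  \sum_(i < n) ((n - i)%:R * zeta_weight n i ^+ 2)
  = n%:R * (n%:R ^+ 2 - 1) / (16 * (n%:R + 2)).
Proof.
have n2 : (n%:R + 2 : K) != 0 by rewrite -natrD addn2 pnatr_eq0.
set c : K := 3 / (n%:R + 2) / 2.
have -> : \sum_(i < n) ((n - i)%:R * zeta_weight n i ^+ 2)
    = (1 - c) ^+ 2 * \sum_(i < n) ((n - i)%:R * 1 ^+ 2)
      - 2 * (1 - c) * c * \sum_(i < n) (n - i)%:R ^+ 2
      + c ^+ 2 * \sum_(i < n) (n - i)%:R ^+ 3.
  rewrite !mulr_sumr -sumrB -big_split; apply: eq_bigr => i _ /=.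
  by rewrite /zeta_weight /c; field.
by rewrite const_weight_norm sum_weight_sqr sum_weight_cube /c; field.
Qed.

Lemma bin2_half (w : nat) : ('C(w.+1, 2)%:R : K) = w%:R * (w%:R + 1) / 2.
Proof.
have : ('C(w.+1, 2) * 2 = w * w.+1)%N.
  by rewrite mulnC mul_bin_left bin1 subn1.
move/(congr1 (fun k => k%:R : K)); rewrite !natrM -(natr1 w) => e.
by rewrite -e mulfK // pnatr_eq0.
Qed.

End Moments.

(** * The second Bessel term of the double-sum Jensen inequality *)

Theorem lemma3 (K : realType) (n : nat) (hn : (0 < n)%N)
  (R : 'M[K]_n) (hR : sym_posdef R)
  (a b : int) (hab : a < b) (u : int -> 'cV[K]_n) :
  J2 R a b u >=
    16 * (ell K a b + 2) / (ell K a b * (ell K a b ^+ 2 - 1))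
    * quadform R (zeta4 a b u).
Proof.
have [m [m0 ->]] : exists m : nat, (0 < m)%N /\ b = a + m%:Z.
  by exists `|b - a|%N; lia.
set L : K := m.+1%:R.
have ellE : ell K a (a + m%:Z) = L.
  by rewrite /ell [a + _]addrC addrK /L -natr1 intrD.
have up2E : upsilon2 a (a + m%:Z) u
    = \sum_(i < m.+1) ((m.+1 - i)%:R * 1) *: u (a + i%:Z).
  rewrite /upsilon2 sum_int_range2; apply: eq_bigr => i _.
  by rewrite mulr1 scaler_nat.
have zetaE : zeta4 a (a + m%:Z) u
    = \sum_(i < m.+1) ((m.+1 - i)%:R * zeta_weight K m.+1 i) *: u (a + i%:Z).
  rewrite /zeta4 ellE up2E /upsilon3 sum_int_range3 scaler_sumr -sumrB.
  apply: eq_bigr => i _.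
  rewrite -[_ *+ 'C(_, _)]scaler_nat bin2_half scalerA -scalerBl.
  by congr (_ *: _); rewrite /zeta_weight; ring.
have L0 : L != 0 by rewrite pnatr_eq0.
have L1 : L + 1 != 0 by rewrite natr1 pnatr_eq0.
have L2 : L + 2 != 0 by rewrite -natrD pnatr_eq0 addn2.
(* L = 1 is where the affine weight degenerates: this uses a < b *)
have Lm1 : L - 1 != 0 by rewrite /L -natr1 addrK pnatr_eq0 -lt0n.
have Lsq : L ^+ 2 - 1 != 0 by rewrite subr_sqr_1 mulf_neq0.
rewrite /J2 ellE zetaE up2E lerBrDl sum_int_range2.
under [leRHS]eq_bigr do rewrite -mulr_natl.
have N1 : L * (L + 1) / 2 != 0 by rewrite !mulf_neq0 // invr_eq0 pnatr_eq0.
have Np : L * (L ^+ 2 - 1) / (16 * (L + 2)) != 0.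
  by rewrite !mulf_neq0 // invr_eq0 mulf_neq0 // pnatr_eq0.
have := weighted_bessel2 K n R _ (fun i : 'I_m.+1 => (m.+1 - i)%:R) (fun=> 1)
  (fun i => zeta_weight K m.+1 i) _ _ (fun i => u (a + i%:Z)) hR
  (fun i => ler0n _ _) N1 Np (const_weight_norm K _) (zeta_weight_norm K _)
  (zeta_weight_orthogonal K _).
by rewrite !invf_div.
Qed.
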